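(* Let $\mathcal{C}$ be a fusion category over $\mathbb{C}$ with Grothendieck ring $K(\mathcal{C})$. The assignment $X\mapsto \mathrm{FPdim}(X)$ extends to a homomorphism of algebras $K(\mathcal{C})\to\mathbb{R}$.
   Context: A fusion category over $\mathbb{C}$ is a $\mathbb{C}$-linear semisimple rigid tensor category with finitely many isomorphism classes of simple objects, finite dimensional Hom spaces, and $\operatorname{End}(\mathbf 1)=\mathbb{C}$. For an object $X\in\mathcal{C}$, $[X]$ denotes the matrix of (left) multiplication by the class of $X$ in $K(\mathcal{C})$ in the basis of classes of simple objects (a matrix with nonnegative integer entries), and the Frobenius–Perron dimension $\mathrm{FPdim}(X)$ is the largest positive real eigenvalue of $[X]$ (with $\mathrm{FPdim}(0)=0$). *)

(* Defs.v *)
From HB Require Import structures.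
From mathcomp Require Import all_boot all_order all_algebra.
From mathcomp Require Import complex.
From mathcomp Require Import all_classical all_reals.

Set Implicit Arguments.
Unset Strict Implicit.
Unset Printing Implicit Defensive.

Import Order.TTheory GRing.Theory Num.Theory.
Local Open Scope ring_scope.

Reserved Notation "g \co f" (at level 40, left associativity).
Reserved Notation "X \ox Y" (at level 39, left associativity).
Reserved Notation "f \om g" (at level 39, left associativity).

Record linear_category (k : fieldType) := LinearCategory {
  obj :> Type;
  hom : obj -> obj -> vectType k;
  idm : forall X, hom X X;
  compm : forall X Y Z, hom Y Z -> hom X Y -> hom X Z;
  comp1m : forall X Y (f : hom X Y), compm (idm Y) f = f;
  compm1 : forall X Y (f : hom X Y), compm f (idm X) = f;
  compmA : forall W X Y Z (h : hom Y Z) (g : hom X Y) (f : hom W X),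
    compm h (compm g f) = compm (compm h g) f;
  comp_linearl : forall X Y Z (a : k) (g g' : hom Y Z) (f : hom X Y),
    compm (a *: g + g') f = a *: compm g f + compm g' f;
  comp_linearr : forall X Y Z (a : k) (g : hom Y Z) (f f' : hom X Y),
    compm g (a *: f + f') = a *: compm g f + compm g f'
}.

Arguments hom {k l} X Y.
Arguments idm {k l} X.
Arguments compm {k l X Y Z} g f.
Notation "g \co f" := (compm g f) : ring_scope.

Section LinearCategory.
Variables (k : fieldType) (C : linear_category k).

Definition inverse_of (X Y : C) (f : hom X Y) (g : hom Y X) : Prop :=
  g \co f = idm X /\ f \co g = idm Y.

Definition is_iso (X Y : C) (f : hom X Y) : Prop := exists g, inverse_of f g.

Definition isomorphic (X Y : C) : Prop := exists f : hom X Y, is_iso f.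

Definition zero_object (Z : C) : Prop :=
  (forall X (f : hom X Z), f = 0) /\ (forall X (f : hom Z X), f = 0).

(* inj and prj exhibit X as the direct sum of the finite family S. *)
Definition direct_sum_maps (n : nat) (S : 'I_n -> C) (X : C)
    (inj : forall t, hom (S t) X) (prj : forall t, hom X (S t)) : Prop :=
  [/\ forall t, prj t \co inj t = idm (S t),
      forall t u, t != u -> prj t \co inj u = 0
    & \sum_(t < n) inj t \co prj t = idm X].

Definition is_direct_sum (n : nat) (S : 'I_n -> C) (X : C) : Prop :=
  exists inj prj, @direct_sum_maps n S X inj prj.

Definition mono (X Y : C) (f : hom X Y) : Prop :=
  forall T (g h : hom T X), f \co g = f \co h -> g = h.

Definition epi (X Y : C) (f : hom X Y) : Prop :=
  forall T (g h : hom Y T), g \co f = h \co f -> g = h.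

Definition is_kernel (X Y K : C) (f : hom X Y) (i : hom K X) : Prop :=
  f \co i = 0 /\
  forall T (g : hom T X), f \co g = 0 -> exists! u : hom T K, i \co u = g.

Definition is_cokernel (X Y Q : C) (f : hom X Y) (p : hom Y Q) : Prop :=
  p \co f = 0 /\
  forall T (g : hom Y T), g \co f = 0 -> exists! u : hom Q T, u \co p = g.

Definition abelian_category : Prop :=
  [/\ exists Z : C, zero_object Z,
      forall X Y : C, exists (S : C) (i1 : hom X S) (i2 : hom Y S)
        (p1 : hom S X) (p2 : hom S Y),
        [/\ p1 \co i1 = idm X, p2 \co i2 = idm Y, p1 \co i2 = 0,
            p2 \co i1 = 0 & i1 \co p1 + i2 \co p2 = idm S],
      forall (X Y : C) (f : hom X Y),
        (exists (K : C) (i : hom K X), is_kernel f i) /\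
        (exists (Q : C) (p : hom Y Q), is_cokernel f p),
      forall (X Y : C) (f : hom X Y), mono f ->
        exists (Z : C) (g : hom Y Z), is_kernel g f
    & forall (X Y : C) (f : hom X Y), epi f ->
        exists (Z : C) (g : hom Z X), is_cokernel g f].

Definition simple (X : C) : Prop :=
  ~ zero_object X /\
  forall (Y : C) (m : hom Y X), mono m -> zero_object Y \/ is_iso m.

Definition semisimple : Prop :=
  forall X : C, exists (n : nat) (S : 'I_n -> C),
    (forall t, simple (S t)) /\ is_direct_sum S X.

Definition simple_representatives (n : nat) (S : 'I_n -> C) : Prop :=
  [/\ forall i, simple (S i),
      forall i j, isomorphic (S i) (S j) -> i = j
    & forall X, simple X -> exists i, isomorphic X (S i)].

Definition finitely_many_simples : Prop :=
  exists (n : nat) (S : 'I_n -> C), simple_representatives S.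

End LinearCategory.

Record tensor_category (k : fieldType) := TensorCategory {
  tlin :> linear_category k;
  tens : tlin -> tlin -> tlin;
  tensm : forall X X' Y Y' : tlin,
    hom X X' -> hom Y Y' -> hom (tens X Y) (tens X' Y');
  unit_obj : tlin;
  tensm1 : forall X Y : tlin, tensm (idm X) (idm Y) = idm (tens X Y);
  tensm_comp : forall (X X' X'' Y Y' Y'' : tlin)
    (f' : hom X' X'') (f : hom X X') (g' : hom Y' Y'') (g : hom Y Y'),
    tensm (f' \co f) (g' \co g) = tensm f' g' \co tensm f g;
  tensm_linearl : forall (X X' Y Y' : tlin) (a : k)
    (f f' : hom X X') (g : hom Y Y'),
    tensm (a *: f + f') g = a *: tensm f g + tensm f' g;
  tensm_linearr : forall (X X' Y Y' : tlin) (a : k)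
    (f : hom X X') (g g' : hom Y Y'),
    tensm f (a *: g + g') = a *: tensm f g + tensm f g';
  assoc : forall X Y Z : tlin, hom (tens (tens X Y) Z) (tens X (tens Y Z));
  lunit : forall X : tlin, hom (tens unit_obj X) X;
  runit : forall X : tlin, hom (tens X unit_obj) X;
  assoc_iso : forall X Y Z : tlin, is_iso (assoc X Y Z);
  lunit_iso : forall X : tlin, is_iso (lunit X);
  runit_iso : forall X : tlin, is_iso (runit X);
  assoc_natural : forall (X X' Y Y' Z Z' : tlin)
    (f : hom X X') (g : hom Y Y') (h : hom Z Z'),
    assoc X' Y' Z' \co tensm (tensm f g) h =
    tensm f (tensm g h) \co assoc X Y Z;
  lunit_natural : forall (X X' : tlin) (f : hom X X'),
    lunit X' \co tensm (idm unit_obj) f = f \co lunit X;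
  runit_natural : forall (X X' : tlin) (f : hom X X'),
    runit X' \co tensm f (idm unit_obj) = f \co runit X;
  pentagon : forall W X Y Z : tlin,
    assoc W X (tens Y Z) \co assoc (tens W X) Y Z =
    tensm (idm W) (assoc X Y Z) \co assoc W (tens X Y) Z
      \co tensm (assoc W X Y) (idm Z);
  triangle : forall X Y : tlin,
    tensm (idm X) (lunit Y) \co assoc X unit_obj Y = tensm (runit X) (idm Y)
}.

Arguments tens {k t} X Y.
Arguments tensm {k t X X' Y Y'} f g.
Arguments unit_obj {k} t.
Arguments assoc {k t} X Y Z.
Arguments lunit {k t} X.
Arguments runit {k t} X.
Notation "X \ox Y" := (tens X Y) : ring_scope.
Notation "f \om g" := (tensm f g) : ring_scope.

Section Rigidity.
Variables (k : fieldType) (C : tensor_category k).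

(* D is a left dual of X, equivalently X is a right dual of D.  The zigzag  *)
(* identities are composed with the unitors on one side, so that no inverse *)
(* structure morphism of the unit is needed.                                *)
Definition duality (D X : C) : Prop :=
  exists (ev : hom (D \ox X) (unit_obj C)) (coev : hom (unit_obj C) (X \ox D))
    (assocV : hom (D \ox (X \ox D)) ((D \ox X) \ox D)),
  [/\ inverse_of (assoc D X D) assocV,
      runit X \co (idm X \om ev) \co assoc X D X \co (coev \om idm X) = lunit X
    & lunit D \co (ev \om idm D) \co assocV \co (idm D \om coev) = runit D].

Definition rigid : Prop :=
  forall X : C, (exists D, duality D X) /\ (exists D, duality X D).

End Rigidity.

Record fusion_category (k : closedFieldType) := FusionCategory {
  ftens :> tensor_category k;
  fusion_abelian : abelian_category ftens;
  fusion_semisimple : semisimple ftens;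
  fusion_finite : finitely_many_simples ftens;
  fusion_rigid : rigid ftens;
  fusion_unit : bijective (fun a : k => a *: idm (unit_obj ftens))
}.

Section LinearTheory.
Variables (k : fieldType) (C : linear_category k).
Implicit Types W X Y Z : C.

Definition postc W X Y (g : hom X Y) (f : hom W X) : hom W Y := g \co f.
Definition prec W X Y (f : hom W X) (g : hom X Y) : hom W Y := g \co f.

Fact postc_linear W X Y (g : hom X Y) : linear (@postc W X Y g).
Proof. by move=> a f f'; rewrite /postc comp_linearr. Qed.
HB.instance Definition _ W X Y (g : hom X Y) :=
  GRing.isLinear.Build k (hom W X) (hom W Y) _ (@postc W X Y g)
    (postc_linear g).

Fact prec_linear W X Y (f : hom W X) : linear (@prec W X Y f).
Proof. by move=> a g g'; rewrite /prec comp_linearl. Qed.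
HB.instance Definition _ W X Y (f : hom W X) :=
  GRing.isLinear.Build k (hom X Y) (hom W Y) _ (@prec W X Y f)
    (prec_linear f).

Lemma compm0 W X Y (g : hom X Y) : g \co (0 : hom W X) = 0.
Proof. exact: (linear0 (@postc W X Y g)). Qed.

Lemma comp0m W X Y (f : hom W X) : (0 : hom X Y) \co f = 0.
Proof. exact: (linear0 (@prec W X Y f)). Qed.

Lemma compm_sum W X Y I (r : seq I) (P : pred I) (g : hom X Y)
    (F : I -> hom W X) :
  g \co (\sum_(i <- r | P i) F i) = \sum_(i <- r | P i) g \co F i.
Proof. exact: (linear_sum (@postc W X Y g)). Qed.

Lemma compm_suml W X Y I (r : seq I) (P : pred I) (f : hom W X)
    (F : I -> hom X Y) :
  (\sum_(i <- r | P i) F i) \co f = \sum_(i <- r | P i) F i \co f.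
Proof. exact: (linear_sum (@prec W X Y f)). Qed.

Lemma isomorphic_refl X : isomorphic X X.
Proof. by exists (idm X), (idm X); split; rewrite comp1m. Qed.

Lemma isomorphic_sym X Y : isomorphic X Y -> isomorphic Y X.
Proof. by case=> f [g [gf fg]]; exists g, f. Qed.

Lemma isomorphic_trans Y X Z :
  isomorphic X Y -> isomorphic Y Z -> isomorphic X Z.
Proof.
case=> f [g [gf fg]] [f' [g' [gf' fg']]]; exists (f' \co f), (g \co g'); split.
  by rewrite compmA -(compmA g) gf' compm1 gf.
by rewrite compmA -(compmA f') fg compm1 fg'.
Qed.

Lemma dim_hom_inj (V W : vectType k) (f : {linear V -> W}) (U : {vspace V}) :
  injective f -> \dim (linfun f @: U) = \dim U.
Proof.
move=> injf; apply: limg_dim_eq; apply/eqP; rewrite -subv0; apply/subvP => v.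
rewrite memv_cap memv_ker lfunE memv0 => /andP[_ /eqP fv0].
by apply/eqP; apply: injf; rewrite fv0 linear0.
Qed.

Lemma dim_hom_isor X Y Z :
  isomorphic Y Z -> \dim {: hom X Y} = \dim {: hom X Z}.
Proof.
have le (A B : C) : isomorphic A B -> (\dim {: hom X A} <= \dim {: hom X B})%N.
  case=> f [g [gf _]].
  rewrite -(@dim_hom_inj _ _ (@postc X A B f) {: hom X A}) ?dimvS ?subvf //.
  by move=> u v /(congr1 (compm g)); rewrite /postc !compmA gf !comp1m.
by move=> YZ; apply/eqP; rewrite eqn_leq !le //; apply: isomorphic_sym.
Qed.

Lemma dim_hom_direct_sum n (S : 'I_n -> C) X Y :
  is_direct_sum S X ->
  \dim {: hom Y X} = (\sum_(t < n) \dim {: hom Y (S t)})%N.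
Proof.
case=> inj [prj [pi1 pi0 ip]].
pose U t : {vspace hom Y X} := (linfun (@postc Y _ _ (inj t)) @: fullv)%VS.
have dimU t : \dim (U t) = \dim {: hom Y (S t)}.
  apply: dim_hom_inj => u v /(congr1 (compm (prj t))).
  by rewrite /postc !compmA pi1 !comp1m.
have sumU : (\sum_(t < n) U t)%VS = fullv.
  apply/eqP; rewrite eqEsubv subvf; apply/subvP => f _.
  rewrite -(comp1m f) -ip compm_suml; apply: memv_suml => t _.
  rewrite -compmA -[X in X \in _]/(postc (inj t) (prj t \co f)) -lfunE.
  exact/(subvP (sumv_sup t isT (subvv (U t))))/memv_img/memvf.
rewrite -sumU -(eq_bigr _ (fun t _ => dimU t)).
have /directv_sum_independent/directvP // : forall u,
  (forall t, true -> u t \in U t) -> \sum_(t < n) u t = 0 -> forall t, true -> u t = 0.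
move=> u Uu sum0 t _.
have /memv_imgP[v _ uv] := Uu t isT.
have := congr1 (compm (prj t)) sum0; rewrite compm_sum compm0 (bigD1 t) //=.
rewrite big1 ?addr0 => [|s nst].
  by rewrite uv lfunE /= /postc compmA pi1 comp1m => ->; rewrite compm0.
have /memv_imgP[w _ ->] := Uu s isT.
by rewrite lfunE /= /postc compmA pi0 ?comp0m // eq_sym.
Qed.

Lemma simple_hom_iso X Y (f : hom X Y) :
  abelian_category C -> simple X -> simple Y -> f != 0 -> is_iso f.
Proof.
move=> [_ _ ker _ _] [nzX sX] [_ sY] /eqP nzf.
have [[K [i [fi0 univ]]] _] := ker _ _ f.
have mi : mono i.
  move=> T g h igh; have [|u [_ uniq]] := univ T (i \co g).
    by rewrite compmA fi0 comp0m.
  by rewrite -(uniq g) // -(uniq h).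
case: (sX K i mi) => [[K0 _]|[j [_ ij]]]; last first.
  by case: nzf; rewrite -(compm1 f) -ij compmA fi0 comp0m.
have mf : mono f.
  move=> T g h fgh; apply/eqP; rewrite -subr_eq0; apply/eqP.
  have [|u [<- _]] := univ T (g - h); last by rewrite (K0 _ u) compm0.
  by rewrite -[LHS]/(postc f (g - h)) linearB /= /postc fgh subrr.
by case: (sY X f mf).
Qed.

Lemma is_direct_sum_iso n (S S' : 'I_n -> C) (X : C) :
  (forall t, isomorphic (S t) (S' t)) -> is_direct_sum S X ->
  is_direct_sum S' X.
Proof.
move=> SS' [inj [prj [pi1 pi0 ip]]].
pose f t := projT1 (cid (SS' t)); pose fP t := projT2 (cid (SS' t)).
pose g t := projT1 (cid (fP t)).
have gP t : inverse_of (f t) (g t) := projT2 (cid (fP t)).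
exists (fun t => inj t \co g t), (fun t => f t \co prj t); split=> [t|t u tu|].
- by rewrite compmA -(compmA (f t)) pi1 compm1; case: (gP t).
- by rewrite compmA -(compmA (f t)) pi0 // compm0 comp0m.
rewrite -ip; apply: eq_bigr => t _.
by rewrite compmA -(compmA (inj t)); case: (gP t) => -> _; rewrite compm1.
Qed.

End LinearTheory.

Section Schur.
Import VectorInternalTheory.

Lemma schur (k : closedFieldType) (C : linear_category k) (X Y : C) :
  abelian_category C -> simple X -> simple Y ->
  \dim {: hom X Y} = `[< isomorphic X Y >].
Proof.
move=> abC sX sY; case: asboolP => [XY|nXY]; last first.
  apply/eqP; rewrite dimv_eq0 -subv0; apply/subvP => f _; rewrite memv0.
  apply: contraPT nXY => nzf nXY; apply: nXY; exists f.
  exact: simple_hom_iso nzf.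
rewrite -(dim_hom_isor X XY).
have nz1 : idm X != 0.
  apply/eqP => X0; case: sX => nzX _; apply: nzX.
  split=> Z f; first by rewrite -(comp1m f) X0 comp0m.
  by rewrite -(compm1 f) X0 compm0.
suff -> : ({: hom X X} = <[idm X]>)%VS by rewrite dim_vline nz1.
apply/eqP; rewrite eq_sym eqEsubv subvf; apply/subvP => f _.
pose F (v : 'rV[k]_(dim (hom X X))) := v2r (postc f (r2v v)).
have linF : linear F by move=> a u v; rewrite /F !linearP.
pose FL : {linear _ -> _} := HB.pack F (GRing.isLinear.Build _ _ _ _ F linF).
have n_gt0 : (0 < dim (hom X X))%N.
  rewrite -dimvf lt0n dimv_eq0 -subv0; apply: contra nz1.
  by move=> /subvP/(_ (idm X) (memvf _)); rewrite memv0.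
have [a] : exists a, eigenvalue (lin1_mx FL) a.
  have /closed_rootP [a ra] : size (char_poly (lin1_mx FL)) != 1%N.
    by rewrite size_char_poly; case: (dim _) n_gt0.
  by exists a; rewrite eigenvalue_root_char.
case/eigenvalueP => v; rewrite mul_rV_lin1 => /= Fv nzv.
have fv : f \co (r2v v) = a *: r2v v.
  by apply: (can_inj v2rK); rewrite [LHS]Fv linearZ /= r2vK.
apply/vlineP; exists a; apply/eqP; rewrite -subr_eq0; apply: contraNT nzv.
case/(simple_hom_iso abC sX sX) => g [gf _].
rewrite -(inj_eq (can_inj r2vK)) linear0 -(comp1m (r2v v)) -gf -compmA.
rewrite -[X in g \co X]/(prec (r2v v) (f - a *: idm X)) linearB linearZ /=.
by rewrite /prec fv comp1m subrr compm0.
Qed.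

End Schur.

Section TensorTheory.
Variables (k : fieldType) (C : tensor_category k).
Implicit Types X Y Z : C.

Definition tensml X X' Y Y' (g : hom Y Y') (f : hom X X') :
  hom (X \ox Y) (X' \ox Y') := f \om g.

Fact tensml_linear X X' Y Y' (g : hom Y Y') : linear (@tensml X X' Y Y' g).
Proof. by move=> a f f'; rewrite /tensml tensm_linearl. Qed.
HB.instance Definition _ X X' Y Y' (g : hom Y Y') :=
  GRing.isLinear.Build k (hom X X') (hom (X \ox Y) (X' \ox Y')) _
    (@tensml X X' Y Y' g) (tensml_linear g).

Fact tensmr_linear X X' Y Y' (f : hom X X') : linear (@tensm k C X X' Y Y' f).
Proof. by move=> a g g'; rewrite tensm_linearr. Qed.
HB.instance Definition _ X X' Y Y' (f : hom X X') :=
  GRing.isLinear.Build k (hom Y Y') (hom (X \ox Y) (X' \ox Y')) _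
    (@tensm k C X X' Y Y' f) (tensmr_linear f).

Lemma direct_sum_tensl n (S : 'I_n -> C) X Y :
  is_direct_sum S X -> is_direct_sum (fun t => S t \ox Y) (X \ox Y).
Proof.
case=> inj [prj [pi1 pi0 ip]].
exists (fun t => inj t \om idm Y), (fun t => prj t \om idm Y).
split=> [t|t u tu|].
- by rewrite -tensm_comp pi1 comp1m tensm1.
- by rewrite -tensm_comp pi0 // -[LHS]/(tensml _ 0) linear0.
rewrite -tensm1 -ip -[RHS]/(tensml _ (\sum_t _)) linear_sum /=.
by apply: eq_bigr => t _; rewrite -tensm_comp comp1m.
Qed.

Lemma direct_sum_tensr n (S : 'I_n -> C) X Y :
  is_direct_sum S X -> is_direct_sum (fun t => Y \ox S t) (Y \ox X).
Proof.
case=> inj [prj [pi1 pi0 ip]].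
exists (fun t => idm Y \om inj t), (fun t => idm Y \om prj t).
split=> [t|t u tu|].
- by rewrite -tensm_comp pi1 comp1m tensm1.
- by rewrite -tensm_comp pi0 // linear0.
rewrite -tensm1 -ip linear_sum /=.
by apply: eq_bigr => t _; rewrite -tensm_comp comp1m.
Qed.

End TensorTheory.

Section GrothendieckRing.
Variables (k : closedFieldType) (C : fusion_category k).

Definition num_simples : nat := projT1 (cid (fusion_finite C)).

Definition simple_obj : 'I_num_simples -> C :=
  projT1 (cid (projT2 (cid (fusion_finite C)))).

Lemma simple_objP : simple_representatives simple_obj.
Proof. exact: projT2 (cid (projT2 (cid (fusion_finite C)))). Qed.

(* The multiplicity [X : X_i] of the i-th simple object in X; lemma         *)
(* multiplicity_direct_sum below computes it from any decomposition of X.   *)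
Definition multiplicity (X : C) (i : 'I_num_simples) : nat :=
  \dim {: hom (simple_obj i) X}.

Lemma multiplicity_direct_sum n (S : 'I_n -> C) (X : C) i :
  (forall t, simple (S t)) -> is_direct_sum S X ->
  multiplicity X i = #|[set t | `[< isomorphic (S t) (simple_obj i) >]]|.
Proof.
move=> sS SX; rewrite /multiplicity (dim_hom_direct_sum _ SX) -sum1_card.
rewrite [RHS]big_mkcond /=; apply: eq_bigr => t _; rewrite inE.
have [sO _ _] := simple_objP; rewrite (schur (fusion_abelian C)) //.
rewrite -[RHS]/(nat_of_bool _).
rewrite (_ : `[< _ >] = `[< isomorphic (S t) (simple_obj i) >]).
  by case: asboolP.
by apply/asboolP/asboolP; apply: isomorphic_sym.
Qed.

Lemma multiplicity_iso (X Y : C) i :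
  isomorphic X Y -> multiplicity X i = multiplicity Y i.
Proof. exact: dim_hom_isor. Qed.

Lemma multiplicity_simple i j : multiplicity (simple_obj i) j = (i == j).
Proof.
have [sO uO _] := simple_objP.
rewrite /multiplicity (schur (fusion_abelian C)) //; congr nat_of_bool.
apply/asboolP/eqP => [/uO-> // | ->]; exact: isomorphic_refl.
Qed.

(* The free abelian group on the isomorphism classes of simple objects,     *)
(* which is the Grothendieck group since C is semisimple.                   *)
Definition grothendieck : Type := 'rV[int]_num_simples.
HB.instance Definition _ := GRing.Zmodule.on grothendieck.

Definition cls (X : C) : grothendieck := \row_i (multiplicity X i)%:Z.

Definition K_mul (a b : grothendieck) : grothendieck :=
  \sum_i \sum_j (a 0 i * b 0 j) *: cls (simple_obj i \ox simple_obj j).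

End GrothendieckRing.

Section GrothendieckRingTheory.
Variables (k : closedFieldType) (C : fusion_category k).
Local Notation K := (grothendieck C).

Lemma simple_decomposition (X : C) :
  exists (n : nat) (c : 'I_n -> 'I_(num_simples C)),
    is_direct_sum (fun t => simple_obj (c t)) X.
Proof.
have [n [S [sS SX]]] := fusion_semisimple X.
have [_ _ exO] := simple_objP C.
pose c t := projT1 (cid (exO _ (sS t))).
exists n, c; apply: is_direct_sum_iso SX => t.
exact: projT2 (cid (exO _ (sS t))).
Qed.

Lemma multiplicity_sum n (c : 'I_n -> C) (X : C) i : is_direct_sum c X ->
  multiplicity X i = (\sum_(t < n) multiplicity (c t) i)%N.
Proof. exact: dim_hom_direct_sum. Qed.

Lemma cls_sum n (c : 'I_n -> C) (X : C) : is_direct_sum c X ->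
  cls X = \sum_(t < n) cls (c t).
Proof.
move=> cX; apply/rowP => i; rewrite summxE mxE (multiplicity_sum _ cX).
by rewrite -[LHS]natz natr_sum; apply: eq_bigr => t _; rewrite mxE natz.
Qed.

Lemma cls_iso (X Y : C) : isomorphic X Y -> cls X = cls Y.
Proof. by move=> XY; apply/rowP => i; rewrite !mxE (multiplicity_iso i XY). Qed.

Lemma cls_simple i : cls (simple_obj i : C) = delta_mx 0 i.
Proof. by apply/rowP => j; rewrite !mxE multiplicity_simple eqxx eq_sym natz. Qed.

Lemma grothendieck_basis (a : K) :
  a = \sum_i a 0 i *: (cls (simple_obj i) : 'rV_(num_simples C)).
Proof.
by rewrite [LHS]row_sum_delta; apply: eq_bigr => i _; rewrite cls_simple.
Qed.

Fact K_mulDl : left_distributive (@K_mul k C) +%R.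
Proof.
move=> a b c; rewrite /K_mul -big_split; apply: eq_bigr => i _ /=.
rewrite -big_split; apply: eq_bigr => j _ /=.
by rewrite mxE mulrDl scalerDl.
Qed.

Fact K_mulDr : right_distributive (@K_mul k C) +%R.
Proof.
move=> a b c; rewrite /K_mul -big_split; apply: eq_bigr => i _ /=.
rewrite -big_split; apply: eq_bigr => j _ /=.
by rewrite mxE mulrDr scalerDl.
Qed.

Fact K_mul0l (b : K) : K_mul 0 b = 0.
Proof. by apply: (addrI (K_mul 0 b)); rewrite -K_mulDl !addr0. Qed.

Fact K_mul0r (b : K) : K_mul b 0 = 0.
Proof. by apply: (addrI (K_mul b 0)); rewrite -K_mulDr !addr0. Qed.

Lemma K_mul_suml n (F : 'I_n -> K) (b : K) :
  K_mul (\sum_i F i) b = \sum_i K_mul (F i) b.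
Proof.
exact: (big_morph (fun a => K_mul a b) (fun x y => K_mulDl x y b) (K_mul0l b)).
Qed.

Lemma K_mul_sumr n (F : 'I_n -> K) (b : K) :
  K_mul b (\sum_i F i) = \sum_i K_mul b (F i).
Proof. exact: (big_morph (K_mul b) (K_mulDr b) (K_mul0r b)). Qed.

Lemma K_mulZl m (a b : K) :
  K_mul (m *: a : 'rV_ _) b = m *: (K_mul a b : 'rV_ _).
Proof.
rewrite /K_mul scaler_sumr; apply: eq_bigr => i _.
rewrite scaler_sumr; apply: eq_bigr => j _.
by rewrite mxE scalerA mulrA.
Qed.

Lemma K_mulZr m (a b : K) :
  K_mul a (m *: b : 'rV_ _) = m *: (K_mul a b : 'rV_ _).
Proof.
rewrite /K_mul scaler_sumr; apply: eq_bigr => i _.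
rewrite scaler_sumr; apply: eq_bigr => j _.
by rewrite mxE scalerA mulrCA.
Qed.

Lemma cls_tens_simple i j :
  cls (simple_obj i \ox simple_obj j : C) =
  K_mul (cls (simple_obj i)) (cls (simple_obj j)).
Proof.
rewrite /K_mul (bigD1 i) //= (bigD1 j) //= !cls_simple !mxE !eqxx mulr1 scale1r.
rewrite !big1 ?addr0 // => [i' /negPf ni|j' /negPf nj].
  by rewrite big1 // => j' _; rewrite !mxE eqxx ni mul0r scale0r.
by rewrite !mxE !eqxx nj mulr0 scale0r.
Qed.

Lemma cls_tens (X Y : C) : cls (X \ox Y) = K_mul (cls X) (cls Y).
Proof.
have [n [c cX]] := simple_decomposition X.
have [m [d dY]] := simple_decomposition Y.
rewrite (cls_sum (direct_sum_tensl Y cX)) (cls_sum cX) K_mul_suml.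
apply: eq_bigr => t _.
rewrite (cls_sum (direct_sum_tensr _ dY)) (cls_sum dY) K_mul_sumr.
by apply: eq_bigr => u _; rewrite cls_tens_simple.
Qed.

Lemma grothendieck_ind (P : K -> Prop) :
  (forall a b, P a -> P b -> P (a + b)) -> P 0 ->
  (forall m a, P a -> P (m *: a : 'rV_ _)) -> (forall X, P (cls X)) ->
  forall a, P a.
Proof.
move=> PD P0 PZ Pc a; rewrite (grothendieck_basis a).
by apply: (big_ind P) => // i _; apply: PZ.
Qed.

Fact K_mulA : associative (@K_mul k C).
Proof.
move=> a b c; move: a.
apply: grothendieck_ind => [a a' Ha Ha'||m a Ha|X].
- by rewrite !K_mulDl Ha Ha'.
- by rewrite !K_mul0l.
- by rewrite !K_mulZl Ha.
move: b; apply: grothendieck_ind => [b b' Hb Hb'||m b Hb|Y].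
- by rewrite !(K_mulDl, K_mulDr) Hb Hb'.
- by rewrite !(K_mul0l, K_mul0r).
- by rewrite K_mulZl !K_mulZr K_mulZl Hb.
move: c; apply: grothendieck_ind => [c c' Hc Hc'||m c Hc|Z].
- by rewrite !K_mulDr Hc Hc'.
- by rewrite !K_mul0r.
- by rewrite !K_mulZr Hc.
rewrite -!cls_tens; apply/esym/cls_iso.
exists (assoc X Y Z); exact: assoc_iso.
Qed.

Fact K_mul1 : left_id (cls (unit_obj C)) (@K_mul k C).
Proof.
move=> a; rewrite {2}(grothendieck_basis a) {1}(grothendieck_basis a) K_mul_sumr.
apply: eq_bigr => i _; rewrite K_mulZr -cls_tens; congr (_ *: _); apply: cls_iso.
exists (lunit (simple_obj i)); exact: lunit_iso.
Qed.

Fact K_mulr1 : right_id (cls (unit_obj C)) (@K_mul k C).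
Proof.
move=> a; rewrite {2}(grothendieck_basis a) {1}(grothendieck_basis a) K_mul_suml.
apply: eq_bigr => i _; rewrite K_mulZl -cls_tens; congr (_ *: _); apply: cls_iso.
exists (runit (simple_obj i)); exact: runit_iso.
Qed.

HB.instance Definition _ :=
  GRing.Zmodule_isPzRing.Build K K_mulA K_mul1 K_mulr1 K_mulDl K_mulDr.

Lemma cls1 : cls (unit_obj C) = 1 :> K.
Proof. by []. Qed.

Lemma clsM (X Y : C) : cls (X \ox Y) = cls X * cls Y :> K.
Proof. exact: cls_tens. Qed.

End GrothendieckRingTheory.

Section FPdim.
Variables (R : realType) (C : fusion_category R[i]).

(* Column j holds the coordinates of [X][X_j] in the basis of simples. *)
Definition mult_matrix (X : C) : 'M[int]_(num_simples C) :=
  \matrix_(i, j) (cls X * cls (simple_obj j) : grothendieck C) 0 i.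

Definition largest_positive_eigenvalue n (A : 'M[R]_n) (d : R) : Prop :=
  [/\ eigenvalue A d, 0 < d & forall e, eigenvalue A e -> e <= d].

(* The default value of xget gives FPdim 0 = 0; see FPdim_zero. *)
Definition FPdim (X : C) : R :=
  xget 0 [set d | largest_positive_eigenvalue
                    (map_mx intr (mult_matrix X)) d]%classic.

Lemma FPdim_zero (Z : C) : zero_object Z -> FPdim Z = 0.
Proof.
move=> [Z0 _]; apply: xgetPN => d [/eigenvalueP[v vd nzv] d_gt0 _].
have cZ : cls Z = 0 :> grothendieck C.
  apply/rowP => j; rewrite !mxE; congr Posz; apply/eqP.
  by rewrite dimv_eq0 -subv0; apply/subvP => f _; rewrite (Z0 _ f) mem0v.
move: vd; rewrite (_ : map_mx _ _ = 0); last first.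
  by apply/matrixP => r s; rewrite !mxE cZ mul0r mxE.
rewrite mulmx0 => /esym/eqP; rewrite scaler_eq0 (negPf nzv) orbF.
by rewrite gt_eqF.
Qed.

End FPdim.

(* Main.v *)
Require Import Defs.
From HB Require Import structures.
From mathcomp Require Import all_boot all_order all_algebra.
From mathcomp Require Import complex.
From mathcomp Require Import all_classical all_reals.
From mathcomp Require Import topology normedtype derive.
Import Defs.

(** Let X_1, ..., X_n be the simple objects and S the class of their direct
sum.  Extend scalars from K(C) to R.  The matrix M of right multiplication by
S has positive entries: X_k occurs in X_i X_j for some j, because it occurs in
X_i (X_i^* X_k), the unit being a summand of X_i X_i^*
(mul_simple_sum_gt0).  By the Perron theorem M therefore has an
eigenvector v with positive coordinates, unique up to a scalar
(perron_exists, perron_unique).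

Left multiplication by any a in K(C) commutes with M by associativity, hence
preserves the line of v: a v = f(a) v for a real number f(a)
(regular_eigenvector).  Since K(C) acts on that line, f is a ring
homomorphism.

It remains to see that f([X]) = FPdim X.  The matrix of left multiplication by
[X] is nonnegative and v is a positive eigenvector of it.  Pairing v with the
absolute values of the coordinates of any eigenvector of the transposed matrix
shows that no real eigenvalue exceeds f([X])
(xget_largest_positive_eigenvalue).  If f([X]) = 0, as happens for X = 0, there
is no positive eigenvalue and the default value 0 of FPdim is the right one. *)

Set Implicit Arguments.
Unset Strict Implicit.
Unset Printing Implicit Defensive.

Import Order.TTheory GRing.Theory Num.Theory.
Import numFieldNormedType.Exports.
Local Open Scope ring_scope.

(** * Perron theory of positive matrices *)

Definition positive_row (R : numDomainType) n (v : 'rV[R]_n) : Prop :=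
  forall j, 0 < v 0 j.

Lemma psumr_gt0 (R : numDomainType) (I : finType) (F : I -> R) i :
  (forall j, 0 <= F j) -> 0 < F i -> 0 < \sum_j F j.
Proof.
by move=> F_ge0 Fi; rewrite (bigD1 i) //= ltr_wpDr // sumr_ge0.
Qed.

Lemma positive_row_mulmx (R : numDomainType) n (M : 'M[R]_n) (u : 'rV[R]_n) :
  (forall i j, 0 < M i j) -> (forall j, 0 <= u 0 j) -> u != 0 ->
  positive_row (u *m M).
Proof.
move=> M_gt0 u_ge0 /rV0Pn[i ui] j; rewrite mxE.
apply: (@psumr_gt0 _ _ _ i) => [k|]; first by rewrite mulr_ge0 // ltW.
by rewrite mulr_gt0 // lt_def ui u_ge0.
Qed.

Section PositiveMatrix.
Variables (R : realType) (n : nat) (M : 'M[R]_n).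
Hypothesis M_gt0 : forall i j, 0 < M i j.

Local Notation simplex :=
  [set x : 'rV[R]_n | (forall i, 0 <= x 0 i <= 1) /\ \sum_i x 0 i = 1]%classic.

Lemma compact_simplex : compact simplex.
Proof.
have cube : compact
    [set x : 'rV[R]_n | forall i, `[(0 : R), 1]%classic (x 0 i)].
  by apply: (@rV_compact R _ (fun=> `[0, 1]%classic)) => i; apply: segment_compact.
apply: subclosed_compact cube _ => [|x [x01 _] i /=]; last by rewrite in_itv /= x01.
have csum : continuous (fun x : 'rV[R]_n => \sum_i x 0 i).
  by apply: continuous_big => [|i _]; [exact: add_continuous|exact: coord_continuous].
have -> : simplex = ((\bigcap_i [set x : 'rV[R]_n | `[0%R, 1%R] (x 0%R i)])
    `&` [set x : 'rV[R]_n | (\sum_i x 0 i = 1)%R])%classic.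
  apply/seteqP; split => x [xP x1]; split=> // i; rewrite /= ?in_itv //=.
  by have := xP i I; rewrite /= in_itv.
apply: closedI; last first.
  exact: (closed_comp (fun x _ => csum x) (@closed_eq _ 1)).
apply: closed_bigI => i _.
apply: (@closed_comp _ _ (fun x : 'rV[R]_n => x 0 i)) => [x _|].
  exact: coord_continuous.
exact: itv_closed.
Qed.

Lemma row_mulmx_continuous (A : 'M[R]_n) i :
  continuous (fun x : 'rV[R]_n => (x *m A) 0 i).
Proof.
under eq_fun do rewrite mxE.
apply: continuous_big => [|j _]; first exact: add_continuous.
move=> x; apply: cvgM; [exact: nbhs_filter|exact: coord_continuous|].
by apply: cvg_cst; exact: nbhs_filter.
Qed.

(** Among the points y = x M with x in the simplex, minimize the
Collatz-Wielandt bound max_i (y M)_i / y_i, and let d be the minimum.  If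
y M <> d y then d y - y M is nonnegative and nonzero, so its image under M is
positive, and y M, after rescaling y into the simplex, has a bound smaller
than d. *)
Lemma perron_exists (i0 : 'I_n) :
  exists2 v : 'rV[R]_n, positive_row v & exists d, v *m M = d *: v.
Proof.
(* Evaluating the bound at x M instead of x keeps the denominators away *)
(* from 0 on the whole simplex, so that F is continuous there.          *)
pose F (x : 'rV[R]_n) :=
  \big[Num.max/0]_i ((x *m M *m M) 0 i / (x *m M) 0 i).
have simplex_pos x : simplex x -> positive_row (x *m M).
  case=> x01 x1; apply: positive_row_mulmx => // [j|].
    by case/andP: (x01 j).
  apply: contra_eq_neq x1 => ->; rewrite big1 => [|i _]; last by rewrite mxE.
  by rewrite eq_sym oner_neq0.
have cF : {within simplex, continuous F}%classic.
  apply: continuous_in_subspaceT => x; rewrite inE => /simplex_pos xM_gt0.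
  apply: (@cvg_big _ _ Num.max).
  - exact: max_continuous.
  - exact: nbhs_filter.
  move=> i _; apply: cvgM; first exact: nbhs_filter.
    under eq_fun do rewrite -mulmxA.
    by rewrite -mulmxA; exact: row_mulmx_continuous.
  apply: cvgV; first exact: nbhs_filter.
    by rewrite gt_eqF.
  exact: row_mulmx_continuous.
have simplex_scale (y : 'rV[R]_n) : positive_row y ->
    simplex ((\sum_i y 0 i)^-1 *: y).
  move=> y_gt0; have s_gt0 : 0 < \sum_i y 0 i.
    by apply: (@psumr_gt0 _ _ _ i0) => // i; apply: ltW.
  split=> [i|]; last first.
    under eq_bigr do rewrite mxE.
    by rewrite -mulr_sumr mulVf // gt_eqF.
  rewrite mxE mulrC divr_ge0 ?(ltW (y_gt0 _)) ?(ltW s_gt0) //=.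
  rewrite ler_pdivrMr // mul1r.
  by rewrite (bigD1 i) //= lerDl sumr_ge0 // => j _; apply: ltW.
have [|x] := compact_EVT_min _ compact_simplex cF.
  by exists ((\sum_i (const_mx 1 : 'rV[R]_n) 0 i)^-1 *: const_mx 1);
    apply: simplex_scale => j; rewrite mxE.
rewrite inE => /simplex_pos; set y := x *m M => y_gt0 Fmin.
pose z := y *m M.
have y_neq0 : y != 0 by apply/rV0Pn; exists i0; rewrite gt_eqF.
have z_gt0 : positive_row z by apply: positive_row_mulmx => // j; apply: ltW.
(* By contradiction: suppose that y M differs from d y, where d = F x. *)
exists y => //; exists (F x); apply: contrapT => /eqP; rewrite -subr_eq0.
rewrite -oppr_eq0 opprB => /(positive_row_mulmx M_gt0) w_gt0.
have {}w_gt0 : positive_row ((F x *: y - z) *m M).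
  apply: w_gt0 => j; rewrite mxE [(- z) 0 j]mxE mxE subr_ge0 -ler_pdivrMr //.
  exact: (le_bigmax _ (fun i => z 0 i / y 0 i)).
have /Fmin : (\sum_i y 0 i)^-1 *: y \in simplex.
  by rewrite inE; apply: simplex_scale.
apply/negP; rewrite -ltNge.
have s_neq0 : (\sum_i y 0 i)^-1 != 0.
  by rewrite invr_eq0 gt_eqF //; apply: (@psumr_gt0 _ _ _ i0) => // i; apply: ltW.
have F_gt0 : 0 < F x.
  apply: lt_le_trans (le_bigmax _ (fun i => z 0 i / y 0 i) i0).
  by rewrite divr_gt0.
apply/bigmax_ltP; split=> // i _.
rewrite -/y -!scalemxAl mxE [X in _ / X]mxE -mulf_div divff // mul1r.
rewrite ltr_pdivrMr // -subr_gt0.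
by have := w_gt0 i; rewrite mulmxBl -scalemxAl !mxE.
Qed.

(** Subtract from w the largest multiple t v lying below it, t being the
smallest ratio w_i / v_i.  The difference is nonnegative, vanishes at some
coordinate and is an eigenvector of M for d; were it nonzero, its image under
M would be positive at that coordinate as well. *)
Lemma perron_unique (v w : 'rV[R]_n) d : positive_row v ->
  v *m M = d *: v -> w *m M = d *: w -> exists t, w = t *: v.
Proof.
move=> v_gt0 vM wM; have [i0 _|n0] := pickP [pred j : 'I_n | true]; last first.
  by exists 0; apply/rowP => j; have := n0 j.
have [i _ imin] := @arg_minP _ _ _ i0 xpredT (fun j => w 0 j / v 0 j) isT.
exists (w 0 i / v 0 i); apply/eqP; rewrite -subr_eq0; apply: contraT.
set u := w - _ => /(positive_row_mulmx M_gt0).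
have u_ge0 j : 0 <= u 0 j.
  by rewrite !mxE subr_ge0 -ler_pdivlMr // imin.
move=> /(_ u_ge0 i).
rewrite mulmxBl -scalemxAl vM wM !mxE mulrCA -mulrBr divfK ?subrr ?mulr0 ?ltxx //.
by rewrite gt_eqF.
Qed.

End PositiveMatrix.

Lemma eigenvalue_trmx (F : fieldType) n (A : 'M[F]_n) a :
  eigenvalue A^T a = eigenvalue A a.
Proof.
rewrite !eigenvalue_root_char /char_poly -[in RHS]det_tr; congr (root (\det _) a).
by rewrite /char_poly_mx raddfB /= tr_scalar_mx map_trmx.
Qed.

(** A nonnegative matrix with a positive right eigenvector has the
corresponding eigenvalue d as its largest real one: if w A = e w, then pairing
|w| A >= |e| |w| with v yields d >= |e|.  When d = 0 there is no positive
eigenvalue and xget returns its default, which is d again. *)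
Lemma xget_largest_positive_eigenvalue (R : realType) n (A : 'M[R]_n)
    (v : 'rV[R]_n) d : (0 < n)%N ->
  (forall i j, 0 <= A i j) -> positive_row v -> v *m A^T = d *: v ->
  xget 0 [set e | largest_positive_eigenvalue A e]%classic = d.
Proof.
move=> n_gt0 A_ge0 v_gt0 vA.
have vAE j : \sum_i A j i * v 0 i = d * v 0 j.
  have := congr1 (fun u : 'rV_n => u 0 j) vA; rewrite !mxE => <-.
  by apply: eq_bigr => i _; rewrite mxE mulrC.
have d_ge0 : 0 <= d.
  rewrite -(pmulr_lge0 _ (v_gt0 (Ordinal n_gt0))) -vAE.
  by apply: sumr_ge0 => i _; rewrite mulr_ge0 // ltW.
have le_d e : eigenvalue A e -> e <= d.
  case/eigenvalueP => w wA nzw; apply: le_trans (ler_norm e) _.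
  have [k wk] := rV0Pn _ nzw.
  have s_gt0 : 0 < \sum_j `|w 0 j| * v 0 j.
    apply: (@psumr_gt0 _ _ _ k) => [j|]; first by rewrite mulr_ge0 // ltW.
    by rewrite mulr_gt0 ?normr_gt0.
  rewrite -(ler_pM2r s_gt0) !mulr_sumr.
  have -> : \sum_j d * (`|w 0 j| * v 0 j) =
            \sum_i (\sum_j `|w 0 j| * A j i) * v 0 i.
    under [RHS]eq_bigr do rewrite mulr_suml.
    rewrite exchange_big; apply: eq_bigr => j _; rewrite mulrCA -vAE mulr_sumr.
    by apply: eq_bigr => i _; rewrite mulrA.
  apply: ler_sum => i _; rewrite mulrA (ler_wpM2r (ltW (v_gt0 i))) // -normrM.
  have := congr1 (fun u : 'rV_n => u 0 i) wA; rewrite !mxE => <-.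
  apply: le_trans (ler_norm_sum _ _ _) _.
  by apply: ler_sum => j _; rewrite normrM (ger0_norm (A_ge0 _ _)).
have dA : eigenvalue A d.
  rewrite -eigenvalue_trmx; apply/eigenvalueP; exists v => //.
  by apply/rV0Pn; exists (Ordinal n_gt0); rewrite gt_eqF.
have [/eqP d0|d_neq0] := boolP (d == 0).
  rewrite d0 xgetPN // => e [/le_d].
  by rewrite d0 => /le_lt_trans/[apply]; rewrite ltxx.
have dP : largest_positive_eigenvalue A d.
  by split=> //; rewrite lt_def d_neq0.
case: xgetP => [e -> [eA _ /(_ _ dA) de]|/(_ d) //].
by apply/eqP; rewrite eq_le de le_d.
Qed.

(** * The unit object and duals in a fusion category *)

Lemma dim_hom_gt0 (k : fieldType) (C : linear_category k) (X Y : C)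
    (f : hom X Y) : f != 0 -> (0 < \dim {: hom X Y})%N.
Proof.
rewrite lt0n dimv_eq0; apply: contra => /eqP hom0.
by rewrite -memv0 -hom0 memvf.
Qed.

Lemma idm_simple_neq0 (k : fieldType) (C : linear_category k) (X : C) :
  simple X -> idm X != 0.
Proof.
case=> nzX _; apply/eqP => X0; apply: nzX; split=> Y f.
  by rewrite -(comp1m f) X0 comp0m.
by rewrite -(compm1 f) X0 compm0.
Qed.

Section FusionRing.
Variables (k : closedFieldType) (C : fusion_category k).
Local Notation K := (grothendieck C).
Local Notation n := (num_simples C).

(** A simple summand of 1 cuts out a nonzero idempotent of End(1), which is
one-dimensional; the idempotent is a scalar, hence the identity. *)
Lemma unit_simple : exists c, isomorphic (simple_obj c) (unit_obj C).
Proof.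
have [[|m] [c [inj [prj [pi1 _ ip]]]]] := simple_decomposition (unit_obj C).
  have /bij_inj inj1 := fusion_unit C.
  rewrite big_ord0 in ip.
  by have /inj1/eqP : 0 *: idm (unit_obj C) = 1 *: idm (unit_obj C);
    rewrite -?ip ?scaler0 // eq_sym oner_eq0.
exists (c ord0), (inj ord0), (prj ord0); split; first exact: pi1.
have [h _ hK] := fusion_unit C.
set e := inj ord0 \co prj ord0.
have eE : h e *: idm _ = e by exact: hK.
have prj_neq0 : prj ord0 != 0.
  have [sO _ _] := simple_objP C.
  apply: contra_neq (idm_simple_neq0 (sO (c ord0))) => p0.
  by rewrite -pi1 p0 comp0m.
suff e1 : h e = 1 by rewrite -eE e1 scale1r.
have : (h e - 1) *: prj ord0 = 0.
  rewrite scalerBl scale1r.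
  rewrite -{1}(compm1 (prj ord0)) -[_ \co idm _]/(postc (prj ord0) (idm _)).
  by rewrite -linearZ /= eE /postc compmA pi1 comp1m subrr.
by move=> /eqP; rewrite scaler_eq0 (negPf prj_neq0) orbF subr_eq0 => /eqP.
Qed.

(** The zigzag identity factors the left unitor of X through the
coevaluation, so that the coevaluation vanishes only when X does. *)
Lemma duality_hom_neq0 (D X : C) : duality D X -> idm X != 0 ->
  exists f : hom (unit_obj C) (X \ox D), f != 0.
Proof.
case=> ev [coev [assocV [_ zigzag _]]] nzX; exists coev.
apply: contra_neq nzX => coev0.
have [l' [_ ll']] := lunit_iso X.
rewrite -ll' -zigzag coev0 -[0 \om _]/(tensml _ 0) linear0.
by rewrite compm0 comp0m.
Qed.

Definition K_nonneg (a : K) : Prop := forall i, 0 <= a 0 i.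

Lemma K_nonneg_cls (X : C) : K_nonneg (cls X).
Proof. by move=> i; rewrite mxE. Qed.

Lemma K_nonneg_mul (a b : K) : K_nonneg a -> K_nonneg b -> K_nonneg (a * b).
Proof.
move=> a_ge0 b_ge0 i; rewrite summxE sumr_ge0 // => p _.
by rewrite summxE sumr_ge0 // => q _; rewrite !mxE !mulr_ge0.
Qed.

(** The unit is simple, so a nonzero map from it to X shows that it occurs in
X with positive multiplicity. *)
Lemma K_nonneg_sub1 (X : C) (f : hom (unit_obj C) X) :
  f != 0 -> K_nonneg (cls X - 1).
Proof.
move=> nzf; have [c c1] := unit_simple.
have -> : (1 : K) = (delta_mx 0 c : 'rV_n) by rewrite -cls_simple -cls1 (cls_iso c1).
move=> i; rewrite !mxE eqxx /= eq_sym subr_ge0.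
case: eqP => [<-|_ //]; rewrite lez_nat.
have [g [g' [_ gg']]] := c1.
apply: (@dim_hom_gt0 _ _ _ _ (f \co g)); apply: contra_neq nzf => fg0.
by rewrite -(compm1 f) -gg' compmA fg0 comp0m.
Qed.

Lemma mulr_simple_sum (a b : K) i :
  (a * b) 0 i = \sum_j b 0 j * (a * cls (simple_obj j) : K) 0 i.
Proof.
rewrite {1}(grothendieck_basis b) [_ * _]K_mul_sumr summxE.
by apply: eq_bigr => j _; rewrite K_mulZr mxE.
Qed.

Definition simple_sum : K := \sum_j cls (simple_obj j).

(** With D a left dual of X_i, the class of X_i D X_j is that of X_j plus a
nonnegative one, hence has a positive X_j-coordinate.  Expanding D X_j into
simple objects, some X_i X_l has a positive X_j-coordinate too. *)
Lemma mul_simple_sum_gt0 i j :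
  0 < (cls (simple_obj i) * simple_sum : K) 0 j.
Proof.
have [sO _ _] := simple_objP C.
have [[D duD] _] := fusion_rigid (simple_obj i).
have [f nzf] := duality_hom_neq0 duD (idm_simple_neq0 (sO i)).
have terms_ge0 l : 0 <= (cls (simple_obj i) * cls (simple_obj l) : K) 0 j.
  by rewrite -clsM K_nonneg_cls.
rewrite [_ * _]K_mul_sumr summxE lt_def sumr_ge0 ?andbT => [|l _]; last exact: terms_ge0.
apply: contraT; rewrite negbK psumr_eq0 => [/allP all0|l _]; last first.
  exact: terms_ge0.
have : 0 < (cls (simple_obj i) * (cls D * cls (simple_obj j)) : K) 0 j.
  rewrite mulrA -clsM -(subrK 1 (cls (_ \ox _) : K)) mulrDl mul1r mxE.
  apply: ltr_wpDl; last by rewrite mxE multiplicity_simple eqxx.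
  by apply: K_nonneg_mul; [exact: K_nonneg_sub1 nzf|exact: K_nonneg_cls].
rewrite mulr_simple_sum big1 ?ltxx // => l _.
by rewrite (eqP (all0 l (mem_index_enum l))) mulr0.
Qed.

(** * Left and right multiplications as matrices *)

(** Multiplications are retyped on row vectors because the Grothendieck ring
carries no module structure, which linear maps and their matrices require. *)
Definition lmul (a : K) : 'rV[int]_n -> 'rV[int]_n := fun b => K_mul a b.
Definition rmul (b : K) : 'rV[int]_n -> 'rV[int]_n := fun a => K_mul a b.

Fact lmul_linear a : linear (lmul a).
Proof. by move=> m b b'; rewrite /lmul [LHS]K_mulDr K_mulZr. Qed.
HB.instance Definition _ a :=
  GRing.isLinear.Build int 'rV[int]_n 'rV[int]_n _ (lmul a) (lmul_linear a).

Fact rmul_linear b : linear (rmul b).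
Proof. by move=> m a a'; rewrite /rmul [LHS]K_mulDl K_mulZl. Qed.
HB.instance Definition _ b :=
  GRing.isLinear.Build int 'rV[int]_n 'rV[int]_n _ (rmul b) (rmul_linear b).

Lemma eq_mul_row (A B : 'M[int]_n) : (forall u : 'rV_n, u *m A = u *m B) -> A = B.
Proof. by move=> AB; apply/row_matrixP => i; rewrite !rowE AB. Qed.

Lemma lmul_mxD (a b : K) :
  lin1_mx (lmul (a + b)) = lin1_mx (lmul a) + lin1_mx (lmul b).
Proof.
by apply: eq_mul_row => u; rewrite mulmxDr !mul_rV_lin1; apply: K_mulDl.
Qed.

Lemma lmul_mx1 : lin1_mx (lmul 1) = 1%:M.
Proof. by apply: eq_mul_row => u; rewrite mul_rV_lin1 mulmx1; apply: K_mul1. Qed.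

(** The order is reversed because matrices act on row vectors from the
right. *)
Lemma lmul_mxM (a b : K) :
  lin1_mx (lmul (a * b)) = lin1_mx (lmul b) *m lin1_mx (lmul a).
Proof.
by apply: eq_mul_row => u; rewrite mulmxA !mul_rV_lin1; apply/esym/K_mulA.
Qed.

Lemma lmul_rmul_mxC (a b : K) :
  lin1_mx (lmul a) *m lin1_mx (rmul b) = lin1_mx (rmul b) *m lin1_mx (lmul a).
Proof.
by apply: eq_mul_row => u; rewrite !mulmxA !mul_rV_lin1; apply/esym/K_mulA.
Qed.

End FusionRing.

(** * The positive eigenvector common to all left multiplications *)

Section RegularEigenvector.
Variables (R : realType) (C : fusion_category R[i]).
Local Notation K := (grothendieck C).
Local Notation n := (num_simples C).

Definition lmulR (a : K) : 'M[R]_n := map_mx intr (lin1_mx (lmul a)).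
Definition rmulR (b : K) : 'M[R]_n := map_mx intr (lin1_mx (rmul b)).

Lemma mult_matrix_trmx (X : C) :
  (map_mx intr (mult_matrix X))^T = lmulR (cls X).
Proof. by apply/matrixP => i j; rewrite !mxE cls_simple. Qed.

(** Left multiplications commute with right multiplication by the sum of the
simple objects, whose Perron eigenspace is a line; they act on it by
scalars. *)
Lemma regular_eigenvector : exists2 v : 'rV[R]_n, positive_row v &
  exists f : K -> R, forall a, v *m lmulR a = f a *: v.
Proof.
have [i0 _] := unit_simple C.
have S_gt0 i j : 0 < rmulR (simple_sum C) i j.
  by rewrite !mxE ltr0z -cls_simple; exact: mul_simple_sum_gt0.
have [v v_gt0 [d vS]] := perron_exists S_gt0 i0.
exists v => //; exists (fun a => (v *m lmulR a) 0 i0 / v 0 i0) => a.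
have [|t vt] := @perron_unique _ _ _ S_gt0 v (v *m lmulR a) d v_gt0 vS.
  by rewrite -mulmxA -map_mxM lmul_rmul_mxC map_mxM mulmxA vS scalemxAl.
by rewrite vt mxE mulfK // gt_eqF.
Qed.
End RegularEigenvector.

Theorem theorem8p6 (R : realType) (C : fusion_category R[i]) :
  exists f : {rmorphism grothendieck C -> R}, forall X : C, f (cls X) = FPdim X.
Proof.
have [v v_gt0 [f vf]] := regular_eigenvector C.
have [i0 _] := unit_simple C.
have inj_v a b : a *: v = b *: v -> a = b.
  by move=> /rowP/(_ i0); rewrite !mxE => /(mulIf (lt0r_neq0 (v_gt0 i0))).
have fD a b : f (a + b) = f a + f b.
  by apply: inj_v; rewrite scalerDl -!vf /lmulR lmul_mxD map_mxD mulmxDr.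
have f0 : f 0 = 0 by apply: (addrI (f 0)); rewrite -fD !addr0.
have f1 : f 1 = 1.
  by apply: inj_v; rewrite scale1r -vf /lmulR lmul_mx1 map_mx1 mulmx1.
have fM a b : f (a * b) = f a * f b.
  apply: inj_v; rewrite mulrC -scalerA -!vf /lmulR lmul_mxM map_mxM mulmxA.
  by rewrite [v *m _]vf -scalemxAl vf.
pose fN := GRing.isNmodMorphism.Build _ _ f (conj f0 fD).
pose fMo := GRing.isMonoidMorphism.Build _ _ f (conj f1 fM).
pose F : {rmorphism grothendieck C -> R} := HB.pack f fN fMo.
exists F => X /=; apply/esym.
apply: (@xget_largest_positive_eigenvalue _ _ _ v) => // [|i j|].
- exact: leq_ltn_trans (ltn_ord i0).
- by rewrite mxE ler0z mxE -clsM K_nonneg_cls.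
- by rewrite mult_matrix_trmx vf.
Qed.
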